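(* For each positive integer $n$, there is a graph $G$ of $n$ vertices whose treewidth is equal to three and ${\sf sd}(G)\ge\lfloor (n-1)/3\rfloor$.
   Context: Graphs are finite, simple and undirected, with vertex set $V=V(G)=\{1,\dots,n\}$ and edge set $E=E(G)$. Treewidth is the usual graph parameter (the minimum, over all tree decompositions of the graph, of the maximum bag size minus one). ${\cal S}^n_+$ is the set of real symmetric positive semidefinite $n\times n$ matrices. For $c\in[-1,1]^{E}$, the positive semidefinite matrix completion problem ${\rm P}(G,c)$ has feasible set $\{X\in{\cal S}^n_+ : X[i,i]=1\ (i\in V),\ X[i,j]=c(ij)\ (ij\in E)\}$; ${\cal E}(G)$ is the set of $c\in[-1,1]^E$ for which this set is nonempty. A stress is a vector $\omega\in\mathbb{R}^{V\cup E}$; its matrix is $\Omega=\sum_{i\in V}\omega(i)E_{ii}+\sum_{ij\in E}\omega(ij)E_{ij}$, where $E_{ij}=({\bf e}_i{\bf e}_j^{\top}+{\bf e}_j{\bf e}_i^{\top})/2$ and ${\bf e}_i$ is the $i$-th standard basis vector of $\mathbb{R}^n$ (a superscript on $\omega$ is inherited by $\Omega$). For a sequence $\omega^1,\dots,\omega^k$ of stresses put ${\cal V}^0=\mathbb{R}^n$ and ${\cal V}^j=\{x\in\mathbb{R}^n : x^{\top}\Omega^i x=0\ (i=1,\dots,j)\}$. Singularity degree: for $c\in{\cal E}(G)$, ${\sf sd}(G,c)=0$ if ${\rm P}(G,c)$ has a positive definite feasible solution; otherwise ${\sf sd}(G,c)$ is the smallest $k$ for which there are stresses $\omega^1,\dots,\omega^k$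 such that: (1) for each $j$, $x^{\top}\Omega^j x\ge 0$ for all $x\in{\cal V}^{j-1}$; (2) for each $j$, $\sum_{i\in V}\omega^j(i)+\sum_{ij\in E}\omega^j(ij)c(ij)\le 0$; (3) $\dim{\cal V}^k=s$, where $s$ is the maximum rank of a feasible solution of ${\rm P}(G,c)$. Finally ${\sf sd}(G)=\max\{{\sf sd}(G,c) : c\in{\cal E}(G)\}$.
   Formalization: The claim is proved for every n ≥ 4 instead of every positive integer n, because a graph on n ≤ 3 vertices has treewidth at most n − 1 ≤ 2 and so cannot have treewidth three. *)

(* Defs.v *)
From HB Require Import structures.
From mathcomp Require Import all_boot all_order all_algebra.
From mathcomp Require Import reals.

Set Implicit Arguments.
Unset Strict Implicit.
Unset Printing Implicit Defensive.

Import Order.TTheory GRing.Theory Num.Theory.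

Local Open Scope ring_scope.

Record sgraph (T : finType) := SGraph {
  adj :> rel T;
  adj_sym : symmetric adj;
  adj_irrefl : irreflexive adj
}.

Definition is_tree (T : finType) (t : sgraph T) : Prop :=
  [/\ (0 < #|T|)%N,
      forall x y : T, connect t x y
    & forall s : seq T, (2 < size s)%N -> ~~ ucycleb t s].

Record is_tree_decomposition (V : finType) (G : sgraph V)
    (T : finType) (t : sgraph T) (B : T -> {set V}) : Prop := TreeDecomposition {
  td_tree : is_tree t;
  td_vertex : forall v : V, exists x : T, v \in B x;
  td_edge : forall u v : V, G u v -> exists x : T, (u \in B x) && (v \in B x);
  (* the nodes whose bags contain v induce a connected subgraph of t *)
  td_connected : forall (v : V) (x y : T), v \in B x -> v \in B y ->
    connect [rel a b | [&& t a b, v \in B a & v \in B b]] x y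
}.

Definition width (V T : finType) (B : T -> {set V}) : nat :=
  (\max_(x : T) #|B x|).-1.

Definition is_treewidth (V : finType) (G : sgraph V) (w : nat) : Prop :=
  (exists (T : finType) (t : sgraph T) (B : T -> {set V}),
      is_tree_decomposition G t B /\ width B = w) /\
  (forall (T : finType) (t : sgraph T) (B : T -> {set V}),
      is_tree_decomposition G t B -> (w <= width B)%N).

(* Each undirected edge ij is represented once, by the pair (i, j) with i < j. *)
Definition edge (n : nat) (G : sgraph 'I_n) : finType :=
  {p : 'I_n * 'I_n | (p.1 < p.2)%N && G p.1 p.2}.

Definition src (n : nat) (G : sgraph 'I_n) (e : edge G) : 'I_n := (val e).1.
Definition tgt (n : nat) (G : sgraph 'I_n) (e : edge G) : 'I_n := (val e).2.

Section Completion.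

Variable R : realType.
Variable n : nat.

Definition qform (A : 'M[R]_n) (x : 'cV[R]_n) : R := (x^T *m A *m x) 0 0.

Definition psd (A : 'M[R]_n) : Prop :=
  A^T = A /\ forall x : 'cV[R]_n, 0 <= qform A x.

Definition posdef (A : 'M[R]_n) : Prop :=
  A^T = A /\ forall x : 'cV[R]_n, x != 0 -> 0 < qform A x.

Variable G : sgraph 'I_n.

Definition feasible (c : edge G -> R) (X : 'M[R]_n) : Prop :=
  [/\ psd X,
      forall i : 'I_n, X i i = 1
    & forall e : edge G, X (src e) (tgt e) = c e].

(* The set written calligraphic E(G). *)
Definition completable (c : edge G -> R) : Prop :=
  (forall e : edge G, -1 <= c e <= 1) /\ exists X : 'M[R]_n, feasible c X.

Definition stress : Type := ('I_n + edge G)%type -> R.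

Definition Emx (i j : 'I_n) : 'M[R]_n :=
  2^-1 *: (delta_mx i j + delta_mx j i).

Definition stress_mx (w : stress) : 'M[R]_n :=
  \sum_(i < n) w (inl i) *: Emx i i +
  \sum_(e : edge G) w (inr e) *: Emx (src e) (tgt e).

Definition stress_pairing (c : edge G -> R) (w : stress) : R :=
  \sum_(i < n) w (inl i) + \sum_(e : edge G) w (inr e) * c e.

(* The set V^j; the stress written omega^(i+1) with 1-based indices is [w i]. *)
Definition Vset (k : nat) (w : 'I_k -> stress) (j : nat) (x : 'cV[R]_n) : Prop :=
  forall i : 'I_k, (i < j)%N -> qform (stress_mx (w i)) x = 0.

(* V^j is not a linear subspace for arbitrary stresses, so that the set being
   a subspace is part of the assertion that it has dimension d. *)
Definition has_dim (S : 'cV[R]_n -> Prop) (d : nat) : Prop :=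
  exists W : {vspace 'cV[R]_n}, (forall x, S x <-> x \in W) /\ \dim W = d.

Definition is_max_rank (c : edge G -> R) (s : nat) : Prop :=
  (exists X : 'M[R]_n, feasible c X /\ \rank X = s) /\
  (forall X : 'M[R]_n, feasible c X -> (\rank X <= s)%N).

Definition sd_sequence (c : edge G -> R) (k : nat) (w : 'I_k -> stress) : Prop :=
  [/\ forall (j : 'I_k) (x : 'cV[R]_n), Vset w j x -> 0 <= qform (stress_mx (w j)) x,
      forall j : 'I_k, stress_pairing c (w j) <= 0
    & exists s : nat, is_max_rank c s /\ has_dim (Vset w k) s].

Definition has_posdef_solution (c : edge G -> R) : Prop :=
  exists X : 'M[R]_n, feasible c X /\ posdef X.

(* sd(G, c) = k *)
Definition is_sd_at (c : edge G -> R) (k : nat) : Prop :=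
  (has_posdef_solution c /\ k = 0%N) \/
  [/\ ~ has_posdef_solution c,
      exists w : 'I_k -> stress, sd_sequence c w
    & forall (l : nat) (w : 'I_l -> stress), sd_sequence c w -> (k <= l)%N].

(* sd(G) = d *)
Definition is_sd (d : nat) : Prop :=
  (exists c : edge G -> R, completable c /\ is_sd_at c d) /\
  (forall (c : edge G -> R) (k : nat), completable c -> is_sd_at c k -> (k <= d)%N).

End Completion.

(* Main.v *)
Require Import Defs.
From mathcomp Require Import all_boot all_order all_algebra.
From mathcomp Require Import boolp reals zify ring lra.

Set Implicit Arguments.
Unset Strict Implicit.
Unset Printing Implicit Defensive.

(** The graph has the clique on 0, 1, 2, 3, followed by vertices m >= 4, each
    joined to its predecessor m - 1 and, alternately, to 0 and to 1 (to the
    vertex [odd m]).  The bags {0, 1, t + 2, t + 3} along a path show that its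
    treewidth is at most three, and a clique is always contained in a bag
    ([clique_in_bag]).

    Place the vertices at q_0 = q_2 = e_0, q_1 = e_1, q_3 = e_2 and
    q_m = q_{m-1} + e_{odd m} in space, and let c be given by the cosines of
    the angles between them.  The normalised points p_m lie on the sphere, and
    p_m is on the geodesic from p_{m-1} to p_{odd m}.  The two short edges at m
    pin p_m to this geodesic, but only once the distance between m - 1 and
    odd m is known; for m >= 5 this pair is not an edge, and its distance
    follows from the relation placing p_{m-1} on its own geodesic.  So all
    feasible solutions have rank at most three ([feasible_rank]), and the linear
    relations between their rows can be discovered one after the other.

    They cannot be discovered faster.  As long as the relation of m - 1 is not
    known, p_{m-1} may move off its geodesic to first order.  This shortens the
    distance from p_{m-1} to p_{odd m} to first order, and lets p_m, p_{m+1}, ...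
    leave the space spanned by the points by an amount of the order of the square
    root of that motion.
    Algebraically, there is a matrix f f^T + sum_k (P_k z_k^T + z_k P_k^T),
    with P_k the coordinate columns of the points, that vanishes on the diagonal
    and on the edges ([flex_eq]), hence is orthogonal to every stress matrix.  If
    a stress is semidefinite on a space containing P_k, z_k and f, and pairs
    nonpositively with c, it therefore vanishes at f
    ([second_order_flex]).  Here f = f_m is supported on the vertices i >= m, and
    the z_k are combinations of f_{m-1} and f_m, so that f_{m-1} and f_m in
    V^j force f_m in V^{j+1}: each step removes at most one of
    f_4, ..., f_{n-1}.  As V^k must become three-dimensional, k >= n - 4
    ([zigzag_sd_ge]), and k >= 1 since V^0 is the whole
    space.

    Finally, the maximum over all c defining the singularity degree of the
    graph exists: in a shortest sequence of stresses the spaces V^j decrease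
    strictly, so its length is at most n ([sd_at_le]).  An explicit sequence of
    stresses ([zigzag_sd_sequence]) shows that the singularity degree of the
    above c is defined. *)

(** * Cliques in tree decompositions *)

Definition remove_edge (T : finType) (t : rel T) (a b : T) : rel T :=
  [rel x y | t x y && ([set x; y] != [set a; b])].

Lemma remove_edge_avoid (T : finType) (t : rel T) (a b x y : T) :
  t x y -> x != a -> y != a -> remove_edge t a b x y.
Proof.
move=> txy xa ya; rewrite /remove_edge /= txy /=; apply/eqP => /setP/(_ a).
by rewrite !inE eqxx (eq_sym a x) (eq_sym a y) (negPf xa) (negPf ya).
Qed.

(** A simple path from [a] to [b] that avoids the edge, closed up by the edge,
    would be a cycle with at least three nodes. *)
Lemma tree_edge_is_bridge (T : finType) (t : sgraph T) (a b : T) :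
  is_tree t -> t a b -> ~~ connect (remove_edge t a b) a b.
Proof.
move=> [_ _ acyclic] tab; apply/negP => /connectP[p0 path_p0 last_p0].
case/shortenP: path_p0 last_p0 => p path_p uniq_p _ last_p.
have path_t : path t a p by apply: sub_path path_p => x y /andP[].
case: p => [|x p] in path_p uniq_p last_p path_t *.
  by rewrite last_p /= adj_irrefl in tab.
case: p => [|y p] in path_p uniq_p last_p path_t *.
  by move: path_p; rewrite (last_p : b = x) /remove_edge /= eqxx andbF.
move/negP: (acyclic [:: a, x, y & p] isT); apply; apply/andP; split => //.
by rewrite /cycle rcons_path path_t -last_p adj_sym.
Qed.

(** Iterating [f] ends in a periodic orbit, which is a cycle of the tree and
    therefore has just two nodes. *)
Lemma tree_orientation_has_reversed_edge (T : finType) (t : sgraph T)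
    (f : T -> T) :
  is_tree t -> (forall x, t x (f x)) -> exists a, f (f a) = a.
Proof.
move=> [/card_gt0P[x0 _] _ acyclic] tf.
have /trajectP[k k_lt iter_k] := looping_order f x0.
pose y := iter k f x0.
have y_periodic : exists m, iter m.+1 f y = y.
  exists (order f x0 - k).-1.
  by rewrite prednK ?subn_gt0 // -iterD subnK // ltnW.
have cyc_f : fcycle f (orbit f y) by apply: (all_iffLR orbitPcycle 3 0).
have iter_y : iter (order f y) f y = y by apply: (all_iffLR orbitPcycle 3 4).
have cyc_t : cycle t (orbit f y).
  by apply: (sub_cycle _ cyc_f) => u v /eqP <-; exact: tf.
have := acyclic (orbit f y); rewrite size_orbit /ucycleb cyc_t orbit_uniq.
case: (order f y) iter_y (order_gt0 f y) => [|[|[|m]]] //= fy _.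
- by have := tf y; rewrite fy adj_irrefl.
- by exists y.
- by move/(_ isT).
Qed.

(** The nodes whose bags contain [v] are connected to each other without
    passing through [x], so they all lie behind a single edge at [x]. *)
Lemma tree_decomposition_side (V T : finType) (G : sgraph V) (t : sgraph T)
    (B : T -> {set V}) (v : V) (x : T) :
  is_tree_decomposition G t B -> v \notin B x ->
  exists y, t x y &&
    [forall z, (v \in B z) ==> connect (remove_edge t x y) y z].
Proof.
move=> [[_ conn _] cov _ subtree] vx; have [z0 vz0] := cov v.
have /connectP[p0 path_p0 last_p0] := conn x z0.
case/shortenP: path_p0 last_p0 => p path_p uniq_p _ last_p.
case: p => [|y p] in path_p uniq_p last_p *.
  by rewrite last_p /= (negPf vx) in vz0.
move: path_p => /= /andP[txy path_p].
exists y; rewrite txy /=; apply/forallP => z; apply/implyP => vz.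
apply: (@connect_trans _ _ z0).
  apply/connectP; exists p; last by rewrite last_p.
  have avoid_x : all (predC1 x) (y :: p).
    move: uniq_p; rewrite cons_uniq => /andP[xyp _].
    by apply/allP => w w_in; apply: contraNneq xyp => <-.
  apply: (sub_in_path _ avoid_x path_p) => a b /= ax bx tab.
  exact: remove_edge_avoid.
apply: (connect_sub _ (subtree _ _ _ vz0 vz)) => a b /and3P[tab va vb].
apply/connect1/remove_edge_avoid => //.
  by apply: contraNneq vx => <-.
by apply: contraNneq vx => <-.
Qed.

(** Otherwise each node misses some vertex of the clique, and can be oriented
    towards the neighbour behind which the bags of that vertex lie.  Some edge
    is then oriented both ways, so the bags of two clique vertices are separated
    by it; but these two vertices share a bag, and the edge is a bridge. *)
Lemma clique_in_bag (V T : finType) (G : sgraph V) (t : sgraph T)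
    (B : T -> {set V}) (S : {set V}) :
  is_tree_decomposition G t B ->
  {in S &, forall u v, u != v -> G u v} -> exists x, S \subset B x.
Proof.
move=> td clique; apply/existsP; apply: contraT => /existsPn no_bag.
have side x : exists y, [exists v in S, t x y &&
    [forall z, (v \in B z) ==> connect (remove_edge t x y) y z]].
  have /subsetPn[v vS vx] := no_bag x.
  have [y Hy] := tree_decomposition_side td vx.
  by exists y; apply/exists_inP; exists v.
have [f Hf] := fin_all_exists side.
have tf x : t x (f x) by case/exists_inP: (Hf x) => v _ /andP[].
have [a faa] := tree_orientation_has_reversed_edge (td_tree td) tf.
have /exists_inP[v vS /andP[_ /forallP side_v]] := Hf a.
have /exists_inP[u uS /andP[_ /forallP]] := Hf (f a); rewrite faa => side_u.
have [w uw vw] : exists2 w, u \in B w & v \in B w.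
  have [->|uv] := eqVneq u v.
    by have [w vw] := td_vertex td v; exists w.
  by have [w /andP[]] := td_edge td (clique _ _ uS vS uv); exists w.
have := tree_edge_is_bridge (td_tree td) (tf a); move/negP; case.
have sym : connect_sym (remove_edge t a (f a)).
  by apply: sym_connect_sym => x y; rewrite /remove_edge /= adj_sym (setUC [set x]).
apply: (@connect_trans _ _ w).
  have := implyP (side_u w) uw.
  by apply: connect_sub => x y /= Hxy; apply: connect1; rewrite /remove_edge (setUC [set a]).
by rewrite sym; exact: implyP (side_v w) vw.
Qed.

Lemma width_ge_clique (V T : finType) (G : sgraph V) (t : sgraph T)
    (B : T -> {set V}) (S : {set V}) :
  is_tree_decomposition G t B ->
  {in S &, forall u v, u != v -> G u v} -> (#|S|.-1 <= width B)%N.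
Proof.
move=> td clique; have [x Sx] := clique_in_bag td clique.
have le_x : (#|B x| <= \max_(y : T) #|B y|)%N by apply: leq_bigmax.
have := subset_leq_card Sx; rewrite /width; lia.
Qed.

(** * Paths as trees *)

Definition path_adj (m : nat) : rel 'I_m :=
  [rel i j : 'I_m | (i.+1 == j :> nat) || (j.+1 == i :> nat)].

Lemma path_adj_sym m : symmetric (@path_adj m).
Proof. by move=> i j; rewrite /path_adj /= orbC. Qed.

Lemma path_adj_irrefl m : irreflexive (@path_adj m).
Proof. by move=> i; rewrite /path_adj /=; lia. Qed.

Definition path_graph m : sgraph 'I_m :=
  SGraph (@path_adj_sym m) (@path_adj_irrefl m).

Lemma path_graph_connect m (P : pred 'I_m) (x y : 'I_m) :
  (forall z : 'I_m, minn x y <= z <= maxn x y -> P z)%N ->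
  connect [rel a b | [&& path_graph m a b, P a & P b]] x y.
Proof.
wlog le_xy : x y / (x <= y)%N => [IH|].
  case/orP: (leq_total x y) => [|le_yx HP]; first exact: IH.
  have sym : connect_sym [rel a b | [&& path_graph m a b, P a & P b]].
    by apply: sym_connect_sym => a b /=; rewrite path_adj_sym (andbC (P a)).
  by rewrite sym; apply: IH => // z; rewrite minnC maxnC; exact: HP.
rewrite (minn_idPl le_xy) (maxn_idPr le_xy).
have [d] := ubnP (y - x)%N; elim: d x le_xy => // d IH x le_xy lt_d HP.
have [xy|neq_xy] := eqVneq x y; first by rewrite xy connect0.
have lt_xy : (x < y)%N by rewrite ltn_neqAle le_xy andbT.
pose x' := Ordinal (leq_ltn_trans lt_xy (ltn_ord y)).
apply: (@connect_trans _ _ x').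
  by apply: connect1; rewrite /= /path_adj /= eqxx /= !HP //=; lia.
apply: IH => //= [|z Hz]; first by lia.
by apply: HP; lia.
Qed.

(** Both neighbours of the largest node of a cycle would have to be its
    predecessor on the path. *)
Lemma path_graph_is_tree m : (0 < m)%N -> is_tree (path_graph m).
Proof.
move=> m_gt0; split=> [|x y|s]; first by rewrite card_ord.
  have := @path_graph_connect m xpredT x y (fun _ _ => isT).
  by apply: connect_sub => a b /= /andP[tab _]; apply: connect1.
case: s => // x0 s0 size_s; apply/negP => ucyc.
set s := x0 :: s0 in size_s ucyc *.
have x0_s : x0 \in s by rewrite mem_head.
case: (@arg_maxnP _ x0 (mem s) (@nat_of_ord m) x0_s) => x x_s x_max.
have [i s' rot_s] := rot_to x_s.
have max_s' w : w \in s' -> (w <= x)%N.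
  by move=> w_s'; apply: x_max; rewrite /= -(mem_rot i) rot_s inE w_s' orbT.
move: ucyc size_s; rewrite /ucycleb -(rot_cycle i) -(rot_uniq i) -(size_rot i).
rewrite rot_s.
case: s' {rot_s} max_s' => [|y s'] max_s' //.
rewrite /= rcons_path => /andP[/andP[xy /andP[_ zx]] uniq_s] size_s.
case/lastP: s' => [|s' z] in max_s' xy zx uniq_s size_s *; first by [].
rewrite last_rcons in zx.
have y_le := max_s' y (mem_head _ _).
have z_le : (z <= x)%N by apply: max_s'; rewrite inE mem_rcons mem_head orbT.
have yz : y = z by apply: val_inj; move: xy zx; rewrite /= /path_adj /=; lia.
by move: uniq_s; rewrite yz mem_rcons mem_head andbF.
Qed.

(** * The graph and its treewidth *)

(** The condition for [i < j] to be adjacent: a clique on four vertices,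
    continued by a path whose vertices are joined alternately to 0 and 1. *)
Definition below (i j : nat) : bool :=
  [|| (j < 4)%N, i == j.-1 | i == odd j].

Definition zigzag_adj (n : nat) : rel 'I_n :=
  [rel i j : 'I_n | ((i < j)%N && below i j) || ((j < i)%N && below j i)].

Lemma zigzag_adj_sym n : symmetric (@zigzag_adj n).
Proof. by move=> i j; rewrite /zigzag_adj /= orbC. Qed.

Lemma zigzag_adj_irrefl n : irreflexive (@zigzag_adj n).
Proof. by move=> i; rewrite /zigzag_adj /= ltnn. Qed.

Definition zigzag n : sgraph 'I_n :=
  SGraph (@zigzag_adj_sym n) (@zigzag_adj_irrefl n).

Definition zigzag_bag (n : nat) (t : 'I_(n - 3)) : {set 'I_n} :=
  [set i : 'I_n | (i < 2)%N || (i == t.+2 :> nat) || (i == t.+3 :> nat)].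

Lemma zigzag_decomposition n : (4 <= n)%N ->
  is_tree_decomposition (zigzag n) (path_graph (n - 3)) (@zigzag_bag n).
Proof.
move=> hn; have n3 : (0 < n - 3)%N by rewrite subn_gt0.
have bag_lt i : (i < n)%N -> (i - 3 < n - 3)%N by lia.
split; first exact: path_graph_is_tree.
- move=> v; exists (Ordinal (bag_lt v (ltn_ord v))).
  by rewrite inE /=; lia.
- suff lt_case (u v : 'I_n) : (u < v)%N -> below u v ->
      exists x, (u \in @zigzag_bag n x) && (v \in zigzag_bag x).
    move=> u v /= /orP[/andP[uv Huv]|/andP[vu Hvu]]; first exact: lt_case.
    by have [x xP] := lt_case _ _ vu Hvu; exists x; rewrite andbC.
  move=> uv Huv; exists (Ordinal (bag_lt v (ltn_ord v))).
  by move: Huv; rewrite /below !inE /=; lia.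
- move=> v x y; rewrite !inE => vx vy.
  pose P := [pred z | v \in @zigzag_bag n z].
  apply: (@path_graph_connect _ P) => z.
  by rewrite /= inE; lia.
Qed.

Lemma card_zigzag_bag n (t : 'I_(n - 3)) : (#|zigzag_bag t| <= 4)%N.
Proof.
rewrite cardE; set s := enum _.
have le : {subset map val s <= [:: 0; 1; t.+2; t.+3]}%N.
  by move=> k /mapP[i]; rewrite mem_enum !inE => Hi ->; move: Hi => /=; lia.
rewrite -(size_map val); apply: (uniq_leq_size _ le).
by rewrite map_inj_uniq ?enum_uniq //; exact: val_inj.
Qed.

(** The first four vertices are a clique, which gives the lower bound; applied
    to the decomposition into bags of at most four vertices, the same bound
    shows that its width is exactly three. *)
Lemma zigzag_treewidth n : (4 <= n)%N -> is_treewidth (zigzag n) 3.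
Proof.
move=> hn; pose S := [set i : 'I_n | (i < 4)%N].
have S4 : #|S| = 4.
  have : [set widen_ord hn i | i : 'I_4] = S.
    apply/setP => i; rewrite inE; apply/imsetP/idP => [[j _ ->]|i4].
      exact: (ltn_ord j).
    by exists (Ordinal i4) => //; exact: val_inj.
  move <-; rewrite card_imset ?card_ord // => i j /(congr1 val) ij.
  exact: val_inj.
have clique : {in S &, forall u v, u != v -> zigzag n u v}.
  by move=> u v; rewrite !inE -val_eqE /= /zigzag_adj /below /=; lia.
have lower (T : finType) (t : sgraph T) B :
    is_tree_decomposition (zigzag n) t B -> (3 <= width B)%N.
  by move=> td; have := width_ge_clique td clique; rewrite S4.
split=> [|T t B]; last exact: lower.
have td := zigzag_decomposition hn.
exists _, (path_graph (n - 3)), (@zigzag_bag n); split; first exact: td.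
apply/eqP; rewrite eqn_leq (lower _ _ _ td) andbT /width.
have : (\max_(x < n - 3) #|zigzag_bag x| <= 4)%N.
  by apply/bigmax_leqP => x _; exact: card_zigzag_bag.
by case: (\max_(x < _) _)%N.
Qed.

Import Order.TTheory GRing.Theory Num.Theory.
Local Open Scope ring_scope.

(** * Semidefinite forms on a subspace *)

Section Isotropic.
Variables (R : realType) (V : lmodType R).

Definition lin_closed (S : V -> Prop) : Prop :=
  S 0 /\ forall a x y, S x -> S y -> S (a *: x + y).

Lemma lin_closed_sum (S : V -> Prop) (I : finType) (Q : pred I)
    (a : I -> R) (x : I -> V) :
  lin_closed S -> (forall i, Q i -> S (x i)) -> S (\sum_(i | Q i) a i *: x i).
Proof.
move=> [S0 S_lin] Sx; apply: (big_ind S) => // [u v Su Sv|i Qi].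
  by rewrite -(scale1r u); exact: S_lin.
by rewrite -[_ *: _]addr0; apply: S_lin => //; exact: Sx.
Qed.

(** Since [B x x = 0], the value of the form at t x + y is affine in t; being
    nonnegative, it is constant, and its slope is 2 B(x, y). *)
Lemma isotropic_orthogonal (B : V -> V -> R) (S : V -> Prop) x y :
  (forall u v, B u v = B v u) ->
  (forall a u v z, B (a *: u + v) z = a * B u z + B v z) ->
  lin_closed S -> (forall u, S u -> 0 <= B u u) ->
  S x -> B x x = 0 -> S y -> B x y = 0.
Proof.
move=> BC BDl [_ S_lin] B_ge0 Sx Bx Sy; apply/eqP; apply: contraT => b_neq0.
set b := B x y in b_neq0 *.
(* at this [t] the affine function t -> B(t x + y, t x + y) takes value -1 *)
pose t := - (B y y + 1) / (2 * b).
have := B_ge0 _ (S_lin t _ _ Sx Sy).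
rewrite BDl !(BC _ (t *: x + y)) !BDl Bx (BC y x) -/b.
have -> : t * (t * 0 + b) + (t * b + B y y) = -1.
  by rewrite /t; field.
by move=> ?; lra.
Qed.

End Isotropic.

(** * Stresses and second-order flexes *)

Section Stress.
Variables (R : realType) (n : nat) (G : sgraph 'I_n).
Implicit Types (w : stress R G) (x y z : 'cV[R]_n) (c : edge G -> R).

(** The symmetric bilinear form of [stress_mx w], written over vertices and
    edges so that only the diagonal and edge entries of a matrix paired with
    the stress appear. *)
Definition stress_form w x y : R :=
  \sum_(i < n) w (inl i) * (x i 0 * y i 0) +
  \sum_(e : edge G) w (inr e) *
    (2^-1 * (x (src e) 0 * y (tgt e) 0 + x (tgt e) 0 * y (src e) 0)).

Lemma qform_delta (i j : 'I_n) x : qform (delta_mx i j) x = x i 0 * x j 0.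
Proof.
rewrite /qform -(mul_delta_mx (0 : 'I_1)) mulmxA -mulmxA mxE big_ord1.
by rewrite -rowE -colE !mxE.
Qed.

Lemma qformD (A B : 'M[R]_n) x : qform (A + B) x = qform A x + qform B x.
Proof. by rewrite /qform mulmxDr mulmxDl mxE. Qed.

Lemma qformZ a (A : 'M[R]_n) x : qform (a *: A) x = a * qform A x.
Proof. by rewrite /qform -scalemxAr -scalemxAl mxE. Qed.

Lemma qform_sum (I : finType) (A : I -> 'M[R]_n) x :
  qform (\sum_i A i) x = \sum_i qform (A i) x.
Proof.
by rewrite /qform mulmx_sumr mulmx_suml summxE.
Qed.

Lemma qform_stress w x : qform (stress_mx w) x = stress_form w x x.
Proof.
rewrite /stress_mx qformD !qform_sum; congr (_ + _); apply: eq_bigr => k _;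
  rewrite qformZ /Emx qformZ qformD !qform_delta //.
by congr (_ * _); field.
Qed.

Lemma stress_formC w x y : stress_form w x y = stress_form w y x.
Proof.
congr (_ + _); apply: eq_bigr => k _; congr (_ * _); first exact: mulrC.
by congr (_ * _); ring.
Qed.

Lemma stress_formDl w a x y z :
  stress_form w (a *: x + y) z = a * stress_form w x z + stress_form w y z.
Proof.
rewrite /stress_form mulrDr addrACA !mulr_sumr -!big_split /=.
by congr (_ + _); apply: eq_bigr => k _; rewrite !mxE; ring.
Qed.

Lemma stress_formDr w a x y z :
  stress_form w z (a *: x + y) = a * stress_form w z x + stress_form w z y.
Proof. by rewrite stress_formC stress_formDl !(stress_formC w z). Qed.

Definition facial_psd (k : nat) (w : 'I_k -> stress R G) : Prop :=
  forall (j : 'I_k) x, Vset w j x -> 0 <= qform (stress_mx (w j)) x.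

(** The zero set of a quadratic form is not a subspace in general; it is one
    inside a subspace on which the form is semidefinite. *)
Lemma Vset_lin_closed k (w : 'I_k -> stress R G) j :
  facial_psd w -> lin_closed (Vset w j).
Proof.
move=> w_ge0; elim: j => [|j [IH0 IH]]; first by split.
split=> [i _|a x y Vx Vy i].
  rewrite qform_stress /stress_form !big1 ?addr0 // => k0 _; rewrite !mxE; ring.
have lower z : Vset w j.+1 z -> Vset w j z.
  by move=> Vz i' i'j; apply: Vz; exact: ltnW.
rewrite ltnS leq_eqVlt => /orP[/eqP ij|]; last first.
  by apply: IH; exact: lower.
have w_ge0' u : Vset w j u -> 0 <= stress_form (w i) u u.
  by rewrite -ij -qform_stress; exact: w_ge0.
have x0 : stress_form (w i) x x = 0.
  by rewrite -qform_stress; apply: Vx; rewrite -ij.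
have y0 : stress_form (w i) y y = 0.
  by rewrite -qform_stress; apply: Vy; rewrite -ij.
have xy0 : stress_form (w i) x y = 0.
  exact: (isotropic_orthogonal (stress_formC _) (stress_formDl _) (conj IH0 IH)
    w_ge0' (lower _ Vx) x0 (lower _ Vy)).
rewrite qform_stress stress_formDl !stress_formDr (stress_formC _ y x).
by rewrite x0 y0 xy0; ring.
Qed.

Variables (d : nat) (P : 'I_d -> 'cV[R]_n) (c : edge G -> R).
Hypothesis P_unit : forall i, \sum_k P k i 0 * P k i 0 = 1.
Hypothesis P_edge :
  forall e : edge G, \sum_k P k (src e) 0 * P k (tgt e) 0 = c e.

(** Both sides are the trace of the product of the stress matrix with the Gram
    matrix of the rows of [P]. *)
Lemma pairing_gram w : stress_pairing c w = \sum_k stress_form w (P k) (P k).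
Proof.
rewrite big_split /=; congr (_ + _); rewrite exchange_big /=; apply: eq_bigr.
  by move=> i _; rewrite -mulr_sumr P_unit mulr1.
move=> e _; rewrite -mulr_sumr -P_edge; congr (_ * _); apply: eq_bigr => k _.
by field.
Qed.

Lemma stress_kills_gram w :
  (forall k, 0 <= stress_form w (P k) (P k)) -> stress_pairing c w <= 0 ->
  forall k, stress_form w (P k) (P k) = 0.
Proof.
move=> P_ge0; rewrite pairing_gram => P_le0 k.
have /eqP : \sum_k stress_form w (P k) (P k) = 0.
  by apply: le_anti; rewrite P_le0 sumr_ge0.
by rewrite psumr_eq0 // => /allP/(_ k (mem_index_enum k))/eqP.
Qed.

(** The matrix f f^T + sum_k (P_k z_k^T + z_k P_k^T) vanishes on the diagonal
    and on the edges, so the stress pairs to zero with it.  As the [P k] are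
    isotropic for a form that is semidefinite on [S], the mixed terms are zero
    too, and only the value at [f] remains.  Geometrically, [z] is a first-order
    motion of the points that compensates a displacement by the square root of
    the time in the new direction [f]. *)
Lemma second_order_flex (S : 'cV[R]_n -> Prop) w (f : 'cV[R]_n) (z : 'I_d -> 'cV[R]_n) :
  lin_closed S -> (forall u, S u -> 0 <= stress_form w u u) ->
  stress_pairing c w <= 0 -> (forall k, S (P k)) -> (forall k, S (z k)) ->
  (forall i, f i 0 * f i 0 + 2 * \sum_k P k i 0 * z k i 0 = 0) ->
  (forall e : edge G, f (src e) 0 * f (tgt e) 0 +
    \sum_k (P k (src e) 0 * z k (tgt e) 0 + P k (tgt e) 0 * z k (src e) 0) = 0) ->
  stress_form w f f = 0.
Proof.
move=> S_lin w_ge0 w_le0 SP Sz diag_eq edge_eq.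
have P0 := stress_kills_gram (fun k => w_ge0 _ (SP k)) w_le0.
have Pz k : stress_form w (P k) (z k) = 0.
  exact: (isotropic_orthogonal (stress_formC _) (stress_formDl _) S_lin w_ge0
    (SP k) (P0 k) (Sz k)).
have sum_Pz : \sum_k stress_form w (P k) (z k) =
    \sum_(i < n) w (inl i) * \sum_k P k i 0 * z k i 0 +
    \sum_(e : edge G) w (inr e) * (2^-1 * \sum_k
      (P k (src e) 0 * z k (tgt e) 0 + P k (tgt e) 0 * z k (src e) 0)).
  rewrite big_split /=; congr (_ + _); rewrite exchange_big /=;
    by apply: eq_bigr => e _; rewrite !mulr_sumr.
have <- : stress_form w f f + 2 * \sum_k stress_form w (P k) (z k) = 0.
  rewrite sum_Pz /stress_form mulrDr addrACA !mulr_sumr -!big_split /=.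
  rewrite big1 => [|i _]; last first.
    have := diag_eq i; set s := \sum_k _ => diag_s.
    by transitivity (w (inl i) * (f i 0 * f i 0 + 2 * s)); [ring | rewrite diag_s mulr0].
  rewrite big1 ?addr0 // => e _; have := edge_eq e; set s := \sum_k _ => edge_s.
  transitivity (w (inr e) * (f (src e) 0 * f (tgt e) 0 + s)).
    by field.
  by rewrite edge_s mulr0.
by rewrite big1 // mulr0 addr0.
Qed.

End Stress.

(** * Existence of the singularity degree of a graph *)

Section SingularityDegree.
Variables (R : realType) (n : nat) (G : sgraph 'I_n).
Implicit Types (x y z : 'cV[R]_n) (c : edge G -> R).

(** [bump j m] is the position in the full sequence reached after the first [m]
    stresses of the shortened one; passing [j] costs nothing because its form
    already vanishes there. *)
Lemma Vset_lift k (w : 'I_k.+1 -> stress R G) (j : 'I_k.+1) m x :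
  (forall y, Vset w j y -> qform (stress_mx (w j)) y = 0) ->
  Vset (fun i => w (lift j i)) m x <-> Vset w (bump j m) x.
Proof.
move=> redundant.
have liftE (i : 'I_k) : lift j i = bump j i :> nat by [].
have lt_bump a b : (bump j a < bump j b)%N = (a < b)%N.
  by rewrite !ltnNge leq_bump2.
split=> Vx i im; last by apply: Vx; rewrite liftE lt_bump.
have [i' ii'|ij] := unliftP j i.
  by rewrite ii'; apply: Vx; move: im; rewrite ii' liftE lt_bump.
rewrite ij; apply: redundant => i0 i0j.
have [i' ii'|] := unliftP j i0; last by move=> i0E; rewrite i0E ltnn in i0j.
rewrite ii'; apply: Vx; move: i0j; rewrite ii' liftE => /leq_trans.
have jm : (j <= m)%N by move: im; rewrite ij /bump; case: leqP => // /ltnW; lia.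
by move/(_ _ jm); apply: leq_ltn_trans; rewrite /bump leq_addl.
Qed.

Lemma sd_sequence_lift c k (w : 'I_k.+1 -> stress R G) (j : 'I_k.+1) :
  (forall y, Vset w j y -> qform (stress_mx (w j)) y = 0) ->
  sd_sequence c w -> sd_sequence c (fun i => w (lift j i)).
Proof.
move=> redundant [w_ge0 w_le0 [s [max_s [W [WE dimW]]]]]; split=> [i x|i|].
- by move=> /(Vset_lift _ _ redundant); exact: (w_ge0 (lift j i) x).
- exact: w_le0.
exists s; split=> //; exists W; split=> // x.
rewrite -WE; apply: (iff_trans (Vset_lift _ _ redundant)).
by rewrite /bump -ltnS ltn_ord add1n.
Qed.

(** Vectors x_j in V^j outside V^(j+1) are linearly independent: in a linear
    dependency, the first x_j with a nonzero coefficient would be a combination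
    of later ones, which all belong to V^(j+1). *)
Lemma strict_sequence_length k (w : 'I_k -> stress R G) :
  facial_psd w ->
  (forall j : 'I_k, exists x, Vset w j x /\ qform (stress_mx (w j)) x != 0) ->
  (k <= n)%N.
Proof.
move=> w_ge0 /fin_all_exists[x xP].
pose A := \matrix_(j < k) (x j)^T.
have : row_free A.
  apply: inj_row_free => u uA0; apply/rowP => j; rewrite mxE.
  have [m] := ubnP j; elim: m j => // m IH j jm.
  apply/eqP; apply: contraT => uj; have [Vj] := xP j; move/negP; case.
  suff Vj1 : Vset w j.+1 (x j) by rewrite Vj1.
  have sum0 : \sum_i u 0 i *: x i = 0.
    apply: trmx_inj; rewrite trmx0 -uA0 mulmx_sum_row linear_sum.
    by apply: eq_bigr => i _; rewrite linearZ /= rowK.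
  have -> : x j = \sum_(i : 'I_k | (j < i)%N) (- (u 0 i / u 0 j)) *: x i.
    have -> : \sum_(i : 'I_k | (j < i)%N) (- (u 0 i / u 0 j)) *: x i =
        \sum_(i : 'I_k | i != j) (- (u 0 i / u 0 j)) *: x i.
      rewrite big_mkcond [RHS]big_mkcond; apply: eq_bigr => i _.
      rewrite -val_eqE /=; case: ltngtP => //= ij.
      by rewrite IH ?mul0r ?oppr0 ?scale0r //; lia.
    apply: (scalerI uj); move: sum0; rewrite (bigD1 j) //= => /eqP.
    rewrite addr_eq0 => /eqP ->; rewrite scaler_sumr -sumrN.
    by apply: eq_bigr => i _; rewrite scalerA -scaleNr; congr (_ *: _); field.
  apply: lin_closed_sum; first exact: Vset_lin_closed.
  by move=> i ji i' i'j; have [+ _] := xP i; apply; exact: leq_trans ji.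
by rewrite /row_free => /eqP <-; exact: rank_leq_col.
Qed.

(** A stress of a shortest sequence always cuts down the space, since it could
    be omitted otherwise. *)
Lemma sd_at_le c k : is_sd_at c k -> (k <= n)%N.
Proof.
case=> [[_ ->] //|[_ [w w_seq] minimal]].
case: k w w_seq minimal => // k w w_seq minimal.
have [w_ge0 _ _] := w_seq.
apply: (strict_sequence_length w_ge0) => j; apply: contrapT => no_x.
have redundant y : Vset w j y -> qform (stress_mx (w j)) y = 0.
  by move=> Vy; apply/eqP; apply: contraT => y0; case: no_x; exists y.
by have := minimal _ _ (sd_sequence_lift redundant w_seq); rewrite ltnn.
Qed.

Lemma sd_at_exists c k (w : 'I_k -> stress R G) :
  ~ has_posdef_solution c -> sd_sequence c w -> exists l, is_sd_at c l.
Proof.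
move=> singular w_seq.
pose P l := `[< exists w' : 'I_l -> stress R G, sd_sequence c w' >].
have exP : exists l, P l by exists k; apply/asboolP; exists w.
case: (ex_minnP exP) => l /asboolP exw minimal; exists l; right; split=> //.
by move=> l' w' w'_seq; apply: minimal; apply/asboolP; exists w'.
Qed.

(** The degrees attained at completable [c] are bounded by the number of
    vertices, so one of them is the largest. *)
Lemma is_sd_exists c k : completable c -> is_sd_at c k ->
  exists d, is_sd R G d /\ (k <= d)%N.
Proof.
move=> c_compl c_k.
pose P l := `[< exists c', completable c' /\ is_sd_at (R := R) (G := G) c' l >].
have exP : exists l, P l by exists k; apply/asboolP; exists c.
have P_le l : P l -> (l <= n)%N.
  by move/asboolP => [c' [_]]; exact: sd_at_le.
case: (ex_maxnP exP P_le) => d /asboolP exd max_d.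
exists d; split; last by apply: max_d; apply/asboolP; exists c.
by split=> // c' l Hc' Hl; apply: max_d; apply/asboolP; exists c'.
Qed.

End SingularityDegree.

(** * The points *)

Section Positions.
Variable R : realType.

(** Coordinates of integer points: e_0, e_1, e_0, e_2 for the clique, and then
    each step adds e_1 or e_0 in turn, as [pos_step] says.  Keeping them integer
    makes all relations between them have coefficients 0 and 1; the points of
    the sphere are obtained by dividing by [len]. *)
Definition pos (i k : nat) : nat :=
  match i with
  | 0 => (k == 0)
  | 1 => (k == 1)
  | 2 => (k == 0)
  | _ => match k with 0 => i./2.-1 | 1 => (i - 3)./2 | _ => 1 end
  end%N.

(** A choice of one vertex at each standard basis vector. *)
Definition base (k : nat) : nat := if k is 2 then 3 else k.

Lemma pos_step m k : (4 <= m)%N -> (k < 3)%N ->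
  pos m k = (pos m.-1 k + pos (odd m) k)%N.
Proof.
case: m => [|[|[|[|m]]]] // _.
by case: k => [|[|[|k]]] //= _; case: (boolP (odd m)) => /= om; lia.
Qed.

Lemma pos_base k l : (k < 3)%N -> (l < 3)%N -> pos (base k) l = (k == l).
Proof. by case: k => [|[|[|k]]] //; case: l => [|[|[|l]]]. Qed.

Lemma base_lt4 k : (k < 3)%N -> (base k < 4)%N.
Proof. by case: k => [|[|[|k]]]. Qed.

Definition q (i : nat) (k : 'I_3) : R := (pos i k)%:R.
Definition dot (i j : nat) : R := \sum_(k < 3) q i k * q j k.
Definition len (i : nat) : R := Num.sqrt (dot i i).

Lemma q_step m k : (4 <= m)%N -> q m k = q m.-1 k + q (odd m) k.
Proof. by move=> hm; rewrite /q pos_step // natrD. Qed.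

Lemma q_base (k l : 'I_3) : q (base k) l = (k == l)%:R.
Proof. by rewrite /q pos_base. Qed.

Lemma dotC i j : dot i j = dot j i.
Proof. by apply: eq_bigr => k _; rewrite mulrC. Qed.

Lemma dot_step i m : (4 <= m)%N -> dot i m = dot i m.-1 + dot i (odd m).
Proof.
move=> hm; rewrite /dot -big_split; apply: eq_bigr => k _.
by rewrite (q_step k hm) mulrDr.
Qed.

Lemma dot_base i (k : 'I_3) : dot i (base k) = q i k.
Proof.
rewrite /dot (bigD1 k) //= q_base eqxx mulr1 big1 ?addr0 // => l lk.
by rewrite q_base eq_sym (negPf lk) mulr0.
Qed.

Lemma dot_gt0 i : 0 < dot i i.
Proof.
rewrite /dot !big_ord_recl big_ord0 /q.
by case: i => [|[|[|i]]] /=; nra.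
Qed.

Lemma len_gt0 i : 0 < len i.
Proof. by rewrite sqrtr_gt0 dot_gt0. Qed.

Lemma len_neq0 i : len i != 0.
Proof. by rewrite gt_eqF // len_gt0. Qed.

Lemma len_sqr i : len i * len i = dot i i.
Proof. by rewrite -expr2 sqr_sqrtr // ltW // dot_gt0. Qed.

Lemma len_base (k : 'I_3) : len (base k) = 1.
Proof. by rewrite /len dot_base q_base eqxx sqrtr1. Qed.

(** * The second-order flex *)

Definition height (i : nat) : R := (3 <= i)%N%:R.
Definition rise (m i : nat) : R := (m <= i)%N%:R.
Definition vert (k : 'I_3) : R := (k == 2 :> nat)%:R.

(** The direction in which vertex m - 1 leaves its geodesic: orthogonal to its
    own point and to those of its earlier neighbours, but having inner product
    1/2 with q_m. *)
Definition bend (m : nat) (k : 'I_3) : R :=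
  2^-1 * (q (odd m) k - dot m.-1 (odd m) * vert k).

(** The motion accompanying the displacement [rise m]: the vertices from [m] on
    sink along e_2, by the amount that restores their lengths and mutual
    distances, and vertex m - 1 moves along [bend m]. *)
Definition drift (m i : nat) (k : 'I_3) : R :=
  (i == m.-1)%:R * bend m k - 2^-1 * rise m i * vert k.

Lemma q_vert i : \sum_k q i k * vert k = height i.
Proof.
rewrite /vert !big_ord_recl big_ord0 /q /height /= !mulr0 mulr1 !add0r addr0.
by case: i => [|[|[|i]]].
Qed.

Definition bend_pairing (m i : nat) : R :=
  2^-1 * (dot i (odd m) - height i * dot m.-1 (odd m)).

Lemma q_bend m i : \sum_k q i k * bend m k = bend_pairing m i.
Proof.
rewrite /bend_pairing -q_vert /dot mulr_suml -sumrB mulr_sumr.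
by apply: eq_bigr => k _; rewrite /bend /dot; ring.
Qed.

Lemma dot_odd (a b : bool) : dot a b = (a == b)%:R.
Proof.
rewrite /dot !big_ord_recl big_ord0 /q.
by case: a; case: b; rewrite /= ?mul0r ?mulr0 ?mulr1 ?addr0 ?add0r.
Qed.

Lemma bend_pairing_spec m : (5 <= m)%N ->
  [/\ bend_pairing m m = 2^-1, bend_pairing m m.-1 = 0,
      bend_pairing m m.-2 = 0 & bend_pairing m (odd m.-1) = 0].
Proof.
move=> hm; have height1 i : (3 <= i)%N -> height i = 1.
  by move=> hi; rewrite /height hi.
have step1 : dot m (odd m) = dot m.-1 (odd m) + 1.
  by rewrite dotC dot_step; [rewrite dot_odd eqxx dotC | lia].
have odd_ne : (odd m.-1 == odd m) = false by lia.
have step2 : dot m.-1 (odd m) = dot m.-2 (odd m).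
  rewrite dotC dot_step; last by lia.
  by rewrite (dot_odd (odd m)) eq_sym odd_ne addr0 dotC.
have h0 : height (odd m.-1) = 0 by rewrite /height; case: (odd _).
rewrite /bend_pairing h0 !height1; try lia.
by rewrite step1 step2 dot_odd odd_ne mulr0n; split; field.
Qed.

Lemma drift_pairing m i j : \sum_k q i k * drift m j k =
  (j == m.-1)%:R * bend_pairing m i - 2^-1 * rise m j * height i.
Proof.
rewrite -q_bend -q_vert !mulr_sumr -sumrB; apply: eq_bigr => k _.
by rewrite /drift; ring.
Qed.

(** The diagonal case i = j says that lengths are preserved to second order.
    The crucial edge is (m - 1, m), where the sinking of [m] has to be
    compensated by the bending of m - 1. *)
Lemma flex_eq m i j : (5 <= m)%N -> (i == j) || (i < j)%N && below i j ->
  rise m i * rise m j + \sum_k (q i k * drift m j k + q j k * drift m i k) = 0.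
Proof.
move=> hm ij; rewrite big_split /= !drift_pairing.
have [bm bm1 bm2 bo] := bend_pairing_spec hm.
have {ij} [le_ij ij] : (i <= j)%N /\ [|| i == j, (j < 4)%N, i == j.-1 | i == odd j].
  by move: ij; rewrite /below; case: ltngtP.
rewrite /rise /height; have [jm|mj|jm] := ltngtP j m.-1.
- have -> : (m <= j)%N = false by lia.
  have -> : (m <= i)%N = false by lia.
  have -> : (i == m.-1) = false by lia.
  by rewrite ?mulr0n ?mulr1n; ring.
- have -> : (m <= j)%N by lia.
  have -> : (3 <= j)%N by lia.
  have [im|im] := leqP m i.
    have -> : (3 <= i)%N by lia.
    have -> : (i == m.-1) = false by lia.
    by rewrite ?mulr0n ?mulr1n; field.
  have [im1|im1] := eqVneq i m.-1.
    have -> : j = m by lia.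
    rewrite bm im1; have -> : (3 <= m.-1)%N by lia.
    by rewrite ?eqxx ?mulr0n ?mulr1n; field.
  have -> : (3 <= i)%N = false by lia.
  by rewrite ?mulr0n ?mulr1n; ring.
- have -> : (m <= j)%N = false by lia.
  have -> : (m <= i)%N = false by lia.
  have [im1|im1] := eqVneq i m.-1; first by rewrite jm im1 bm1 ?mulr0n; ring.
  have [->|->] : i = m.-2 \/ i = odd m.-1 by lia.
    by rewrite bm2 ?mulr0n; ring.
  by rewrite bo ?mulr0n; ring.
Qed.
End Positions.

(** * Each step discovers at most one relation *)

Section LowerBound.
Variables (R : realType) (n : nat).
Local Notation G := (zigzag n).
Local Notation q := (q R).
Local Notation len := (len R).
Local Notation rise := (rise R).
Local Notation drift := (drift R).

Definition scaled_col (f : nat -> R) : 'cV[R]_n := \col_i (f i / len i).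

Definition gram_col (k : 'I_3) : 'cV[R]_n := scaled_col (q^~ k).

Definition gram : 'M[R]_n := \matrix_(i, j) \sum_k gram_col k i 0 * gram_col k j 0.

Definition zigzag_cos (e : edge G) : R := gram (src e) (tgt e).

Lemma gramE (i j : 'I_n) : gram i j = dot R i j / (len i * len j).
Proof.
rewrite mxE /dot mulr_suml; apply: eq_bigr => k _; rewrite !mxE.
by field; rewrite !len_neq0.
Qed.

Lemma gram_unit (i : 'I_n) : \sum_k gram_col k i 0 * gram_col k i 0 = 1.
Proof.
have -> : \sum_k gram_col k i 0 * gram_col k i 0 = gram i i by rewrite mxE.
by rewrite gramE len_sqr divff // gt_eqF // dot_gt0.
Qed.

Lemma gram_edge (e : edge G) :
  \sum_k gram_col k (src e) 0 * gram_col k (tgt e) 0 = zigzag_cos e.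
Proof. by rewrite /zigzag_cos mxE. Qed.

Lemma edge_below (e : edge G) :
  (src e < tgt e)%N && below (src e) (tgt e).
Proof.
have /andP[st /orP[//|/andP[ts _]]] := valP e.
by move: (ltn_trans st ts); rewrite ltnn.
Qed.

(** The motion lies in the span of the two displacements [rise m.-1] and
    [rise m], so it is compatible with the relations of all vertices before m - 1. *)
Lemma drift_colE m k : (0 < m)%N ->
  scaled_col (fun i => drift m i k) =
  bend R m k *: scaled_col (rise m.-1) +
    (- (2^-1 * vert R k) - bend R m k) *: scaled_col (rise m).
Proof.
move=> hm; apply/colP => i; rewrite !mxE.
have -> : drift m i k = bend R m k * rise m.-1 i
    + (- (2^-1 * vert R k) - bend R m k) * rise m i.
  rewrite /drift; suff -> : (i == m.-1 :> nat)%:R = rise m.-1 i - rise m i by ring.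
  rewrite /rise; have [im|im|im] := ltngtP i m.-1.
  - by rewrite (_ : (m <= i)%N = false) ?subrr //; lia.
  - by rewrite (_ : (m <= i)%N = true) ?subrr //; lia.
  - by rewrite (_ : (m <= i)%N = false) ?subr0 //; lia.
by ring.
Qed.

(** One step needs both [rise m.-1] and [rise m] in V^j in order to keep
    [rise m] in V^(j+1), so the range of surviving m shrinks by one.  It starts
    with m >= 4, as the flex exists for m >= 5: vertex 4 lies in a triangle with
    0 and 3, and its relation is available at once. *)
Lemma rise_survives k (w : 'I_k -> stress R G) (j m : nat) :
  facial_psd w -> (forall i, stress_pairing zigzag_cos (w i) <= 0) ->
  (j + 4 <= m)%N -> Vset w j (scaled_col (rise m)) /\
  (forall l, Vset w j (gram_col l)).
Proof.
move=> w_ge0 w_le0; elim: j m => [|j IH] m hm; first by split.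
have w_ge0' (i : 'I_k) u : Vset w i u -> 0 <= stress_form (w i) u u.
  by rewrite -qform_stress; exact: w_ge0.
have [rise_m gram_j] := IH m (ltnW hm).
have [rise_m1 _] : Vset w j (scaled_col (rise m.-1)) /\ _ := IH m.-1 ltac:(lia).
split=> [i|l i]; rewrite ltnS leq_eqVlt => /orP[/eqP ij|ij].
- rewrite qform_stress.
  apply: (second_order_flex gram_unit gram_edge (Vset_lin_closed j w_ge0)
    (z := fun k => scaled_col (fun i => drift m i k))).
  + by rewrite -ij; exact: w_ge0'.
  + exact: w_le0.
  + exact: gram_j.
  + move=> l; rewrite drift_colE; last by lia.
    have [V_0 V_lin] := Vset_lin_closed j w_ge0.
    by apply: (V_lin) => //; rewrite -[_ *: _]addr0; exact: V_lin.
  + move=> v; rewrite !mxE.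
    have := @flex_eq R m v v ltac:(lia); rewrite eqxx => /(_ isT) Hv.
    transitivity ((len v)^-1 ^+ 2 * 0); last by rewrite mulr0.
    rewrite -[in RHS]Hv mulrDr; congr (_ + _).
      by field; rewrite len_neq0.
    rewrite !mulr_sumr; apply: eq_bigr => l _; rewrite !mxE.
    by field; rewrite len_neq0.
  + move=> e; rewrite !mxE.
    have := @flex_eq R m (src e) (tgt e) ltac:(lia).
    rewrite edge_below orbT => /(_ isT) Hv.
    transitivity ((len (src e) * len (tgt e))^-1 * 0); last by rewrite mulr0.
    rewrite -[in RHS]Hv mulrDr; congr (_ + _).
      by field; rewrite !len_neq0.
    rewrite !mulr_sumr; apply: eq_bigr => l _; rewrite !mxE.
    by field; rewrite !len_neq0.
- exact: rise_m.
- rewrite qform_stress.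
  apply: (stress_kills_gram gram_unit gram_edge _ (w_le0 i)) => l'.
  by apply: w_ge0'; rewrite ij.
- exact: gram_j.
Qed.

End LowerBound.

(** * A sequence of stresses discovering all relations *)

Section EdgeForms.
Variables (R : realType) (n : nat) (G : sgraph 'I_n).

Definition edge_form (Q : 'cV[R]_n -> R) : Prop :=
  exists w : stress R G, forall x, qform (stress_mx w) x = Q x.

Lemma edge_form_lin a (Q1 Q2 : 'cV[R]_n -> R) : edge_form Q1 -> edge_form Q2 ->
  edge_form (fun x => a * Q1 x + Q2 x).
Proof.
move=> [w1 w1E] [w2 w2E]; exists (fun s => a * w1 s + w2 s) => x.
rewrite -w1E -w2E !qform_stress /stress_form mulrDr addrACA !mulr_sumr.
by rewrite -!big_split /=; congr (_ + _); apply: eq_bigr => k _; ring.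
Qed.

Lemma edge_form0 : edge_form (fun=> 0).
Proof.
exists (fun=> 0) => x.
by rewrite qform_stress /stress_form !big1 ?addr0 // => k _; rewrite mul0r.
Qed.

Lemma edge_form_sum (I : Type) (r : seq I) (a : I -> R)
    (Q : I -> 'cV[R]_n -> R) : (forall i, edge_form (Q i)) ->
  edge_form (fun x => \sum_(i <- r) a i * Q i x).
Proof.
move=> HQ; elim: r => [|i r [w wE]].
  by have [w wE] := edge_form0; exists w => x; rewrite wE big_nil.
have [w' w'E] := edge_form_lin (a i) (HQ i) (ex_intro _ w wE).
by exists w' => x; rewrite w'E big_cons.
Qed.

Lemma edge_form_prod (i j : 'I_n) : (i == j) || G i j ->
  edge_form (fun x => x i 0 * x j 0).
Proof.
wlog le_ij : i j / (i <= j)%N => [IH|].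
  case/orP: (leq_total i j) => [|le_ji] ij; first exact: IH.
  have [|w wE] := IH j i le_ji; first by rewrite eq_sym adj_sym.
  by exists w => x; rewrite wE mulrC.
case: eqVneq => [<- _|ij /= Gij].
  exists (fun s => (s == inl i)%:R) => x.
  rewrite qform_stress /stress_form (bigD1 i) //= eqxx mul1r.
  rewrite !big1 ?addr0 // => [e _|k ki]; first by rewrite mul0r.
  by rewrite (_ : inl k == inl i = (k == i)) // (negPf ki) mul0r.
have lt_ij : (i < j)%N by rewrite ltn_neqAle -(inj_eq val_inj) in ij *; rewrite ij.
have Pij : ((i, j).1 < (i, j).2)%N && G (i, j).1 (i, j).2 by rewrite /= lt_ij.
pose e : edge G := exist _ (i, j) Pij.
exists (fun s => (s == inr e)%:R) => x.
rewrite qform_stress /stress_form big1 => [|k _]; last by rewrite mul0r.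
rewrite (bigD1 e) //= eqxx big1 => [|k ke].
  by rewrite /src /tgt /=; field.
by rewrite (_ : inr k == inr e = (k == e)) // (negPf ke) mul0r.
Qed.

End EdgeForms.

Section UpperBound.
Variables (R : realType) (N : nat).
Local Notation n := N.+4.
Local Notation G := (zigzag n).
Local Notation q := (q R).
Local Notation len := (len R).

Definition vtx (i : nat) : 'I_n := inord i.
Definition base_vtx (k : 'I_3) : 'I_n := vtx (base k).

(** Entries rescaled so that the relation of vertex [m] reads
    scaled m = scaled (m - 1) + scaled (odd m). *)
Definition scaled (x : 'cV[R]_n) (i : nat) : R := len i * x (vtx i) 0.
(** The scaled entry at [i] that the entries at the base vertices predict, if
    [x] is a linear function of the points. *)
Definition extrapolated (x : 'cV[R]_n) (i : nat) : R :=
  \sum_k q i k * x (base_vtx k) 0.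

Lemma vtxK i : (i < n)%N -> vtx i = i :> nat.
Proof. exact: inordK. Qed.

Lemma base_vtxK k : base_vtx k = base k :> nat.
Proof. by rewrite vtxK // (leq_trans (base_lt4 (ltn_ord k))). Qed.

Lemma scaled_base x (k : 'I_3) : scaled x (base k) = x (base_vtx k) 0.
Proof. by rewrite /scaled len_base mul1r. Qed.

Lemma extrapolated_base x (k : 'I_3) : extrapolated x (base k) = x (base_vtx k) 0.
Proof.
rewrite /extrapolated (bigD1 k) //= q_base eqxx mul1r big1 ?addr0 // => l lk.
by rewrite q_base eq_sym (negPf lk) mul0r.
Qed.

Lemma extrapolated_step x m : (4 <= m)%N ->
  extrapolated x m = extrapolated x m.-1 + extrapolated x (odd m).
Proof.
move=> hm; rewrite /extrapolated -big_split /=; apply: eq_bigr => k _.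
by rewrite (q_step R k hm) mulrDl.
Qed.

Lemma base_odd (b : bool) : exists k : 'I_3, base k = b.
Proof. by case: b; [exists 1 | exists 0]. Qed.

Lemma scaled_odd x (b : bool) : scaled x b = extrapolated x b.
Proof. by have [k <-] := base_odd b; rewrite scaled_base extrapolated_base. Qed.

Lemma edge_form_scaled i j : (i < n)%N -> (j < n)%N ->
  [|| i == j, (i < j)%N && below i j | (j < i)%N && below j i] ->
  edge_form G (fun x : 'cV[R]_n => scaled x i * scaled x j).
Proof.
move=> hi hj ij.
have [|w wE] := @edge_form_prod R n G (vtx i) (vtx j).
  by rewrite -val_eqE /= /zigzag_adj /= !vtxK.
have [w' w'E] := edge_form_lin (len i * len j) (ex_intro _ w wE) (edge_form0 R G).
by exists w' => x; rewrite w'E /scaled; ring.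
Qed.

(** For the base vertices the relation is empty and the zero stress serves; vertex
    2 repeats the point of vertex 0. *)
Lemma edge_form_clique_relation m : (m < 4)%N -> exists w : stress R G, forall x,
  qform (stress_mx w) x = (scaled x m - extrapolated x m) ^+ 2.
Proof.
move=> m4; have [->|m2] := eqVneq m 2.
  have F1 := @edge_form_scaled 2 2 isT isT isT.
  have F2 := @edge_form_scaled 2 0 isT isT isT.
  have F3 := @edge_form_scaled 0 0 isT isT isT.
  have F4 := edge_form_lin 1 F3 (edge_form0 R G).
  have [w wE] := edge_form_lin 1 F1 (edge_form_lin (-2) F2 F4).
  exists w => x; rewrite wE.
  have -> : extrapolated x 2 = scaled x 0 by rewrite (scaled_odd x false).
  by ring.
have [k <-] : exists k : 'I_3, base k = m.
  by case: m m4 m2 => [|[|[|[|m]]]] // _ _; [exists 0 | exists 1 | exists 2].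
have [w wE] := edge_form0 R G; exists w => x.
by rewrite wE scaled_base extrapolated_base subrr expr0n.
Qed.

(** The square of scaled m - scaled (m - 1) - scaled (odd m) contains the
    product of the entries at m - 1 and odd m, which are not adjacent.  Once
    the relation of m - 1 is known, the entry at m - 1 is a combination of those
    at the base vertices, which are all adjacent or equal to odd m. *)
Lemma edge_form_relation m : (m < n)%N -> exists w : stress R G, forall x,
  (forall i, (i < m)%N -> scaled x i = extrapolated x i) ->
  qform (stress_mx w) x = (scaled x m - extrapolated x m) ^+ 2.
Proof.
move=> hm; have [m4|m4] := ltnP m 4.
  by have [w wE] := edge_form_clique_relation m4; exists w.
have hm1 : (m.-1 < n)%N by lia.
have ho : (odd m < n)%N by lia.
have F1 := @edge_form_scaled m m hm hm ltac:(lia).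
have F2 := @edge_form_scaled m.-1 m.-1 hm1 hm1 ltac:(lia).
have F3 := @edge_form_scaled (odd m) (odd m) ho ho ltac:(lia).
have F4 := @edge_form_scaled m m.-1 hm hm1 ltac:(rewrite /below; lia).
have F5 := @edge_form_scaled m (odd m) hm ho ltac:(rewrite /below; lia).
have F6 : edge_form G (fun x : 'cV[R]_n =>
    \sum_(k < 3) q m.-1 k * (scaled x (base k) * scaled x (odd m))).
  apply: edge_form_sum => k; apply: edge_form_scaled => //.
    by have := base_lt4 (ltn_ord k); lia.
  by have := base_lt4 (ltn_ord k); rewrite /below; lia.
have [w wE] := edge_form_lin 1 F1 (edge_form_lin 1 F2 (edge_form_lin 1 F3
  (edge_form_lin (-2) F4 (edge_form_lin (-2) F5 (edge_form_lin 2 F6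
  (edge_form0 R G)))))).
exists w => x known; rewrite wE.
have -> : \sum_(k < 3) q m.-1 k * (scaled x (base k) * scaled x (odd m)) =
    extrapolated x m.-1 * scaled x (odd m).
  rewrite /extrapolated mulr_suml; apply: eq_bigr => k _.
  by rewrite scaled_base mulrA.
rewrite (extrapolated_step x m4) (known m.-1); last by lia.
by rewrite scaled_odd; ring.
Qed.

Lemma scaled_gram_col m k : (m < n)%N -> scaled (gram_col R n k) m = q m k.
Proof. by move=> hm; rewrite /scaled !mxE vtxK // mulrC divfK ?len_neq0. Qed.

Lemma gram_col_base (k l : 'I_3) : gram_col R n k (base_vtx l) 0 = (l == k)%:R.
Proof. by rewrite !mxE base_vtxK len_base divr1 q_base. Qed.

Lemma extrapolated_gram_col m k : extrapolated (gram_col R n k) m = q m k.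
Proof.
rewrite /extrapolated (bigD1 k) //= gram_col_base eqxx mulr1 big1 ?addr0 //.
by move=> l lk; rewrite gram_col_base (negPf lk) mulr0.
Qed.

Definition stage_seq (w : 'I_n -> stress R G) : Prop := forall (m : 'I_n) x,
  (forall i, (i < m)%N -> scaled x i = extrapolated x i) ->
  qform (stress_mx (w m)) x = (scaled x m - extrapolated x m) ^+ 2.

Lemma Vset_stage w j x : stage_seq w -> (j <= n)%N ->
  Vset w j x <-> forall i, (i < j)%N -> scaled x i = extrapolated x i.
Proof.
move=> wE; elim: j => [|j IH] hj; first by split=> // _ [].
have {IH} IH := IH (ltnW hj); have wj := wE (Ordinal hj) x.
split=> [Vx|Hx i ij].
  have Hj := (IH.1 (fun i ij => Vx i (ltnW ij))).
  move=> i; rewrite ltnS leq_eqVlt => /orP[/eqP ->|]; last exact: Hj.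
  have := Vx (Ordinal hj) (ltnSn j); rewrite (wj Hj) => /eqP.
  by rewrite sqrf_eq0 subr_eq0 => /eqP.
have Hi i0 : (i0 < i)%N -> scaled x i0 = extrapolated x i0.
  by move=> i0i; apply: Hx; lia.
by rewrite (wE i x Hi) (Hx i ij) subrr expr0n.
Qed.

Definition gram_space : {vspace 'cV[R]_n} :=
  <<[tuple gram_col R n k | k < 3]>>%VS.

Lemma extrapolated_colE x :
  (forall i, (i < n)%N -> scaled x i = extrapolated x i) ->
  x = \sum_(k < 3) x (base_vtx k) 0 *: gram_col R n k.
Proof.
move=> Hx; apply/colP => i; rewrite summxE; have := Hx i (ltn_ord i).
rewrite /scaled /vtx inord_val => xi.
apply: (mulfI (len_neq0 R i)); rewrite xi mulr_sumr; apply: eq_bigr => k _.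
by rewrite !mxE; field; rewrite len_neq0.
Qed.

Lemma gram_tupleE (k : 'I_3) :
  [tuple gram_col R n k | k < 3]`_k = gram_col R n k.
Proof. exact: nth_mktuple. Qed.

Lemma gram_spaceP x :
  x \in gram_space <-> forall i, (i < n)%N -> scaled x i = extrapolated x i.
Proof.
split=> [x_in i hi|Hx].
  rewrite (coord_span x_in); set a := coord _.
  rewrite /scaled /extrapolated summxE mulr_sumr.
  transitivity (\sum_(k < 3) a k x * q i k).
    apply: eq_bigr => k _; rewrite mxE gram_tupleE mulrCA.
    by congr (_ * _); have := scaled_gram_col k hi.
  symmetry; under eq_bigr => k _ do rewrite summxE mulr_sumr.
  rewrite exchange_big /=; apply: eq_bigr => l _.
  rewrite -(extrapolated_gram_col i l) /extrapolated mulr_sumr.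
  by apply: eq_bigr => k _; rewrite mxE gram_tupleE mulrCA.
rewrite (extrapolated_colE Hx); apply: memv_suml => k _; apply/memvZ/memv_span.
by apply/tnthP; exists k; rewrite tnth_mktuple.
Qed.

Lemma gram_free : free [tuple gram_col R n k | k < 3].
Proof.
apply/freeP => a a0 l.
have := congr1 (fun x : 'cV[R]_n => x (base_vtx l) 0) a0.
rewrite summxE mxE (bigD1 l) //= gram_tupleE mxE gram_col_base eqxx.
rewrite mulr1 big1 ?addr0 // => k kl.
rewrite mxE gram_tupleE gram_col_base eq_sym (negPf kl) mulr0 //.
Qed.

Lemma dim_gram_space : \dim gram_space = 3.
Proof. by have := gram_free; rewrite /free size_tuple => /eqP. Qed.

End UpperBound.

(** * Feasible solutions have rank at most three *)

Section Trinomial.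
Variables (R : realType) (n : nat) (A : 'M[R]_n).
Hypothesis A_sym : A^T = A.

Definition bform (x y : 'cV[R]_n) : R := (x^T *m A *m y) 0 0.

Lemma bformC x y : bform x y = bform y x.
Proof.
by rewrite /bform -[LHS]trace_mx11 -mxtrace_tr !trmx_mul trmxK A_sym mulmxA
  trace_mx11.
Qed.

Lemma bformDl a x y z : bform (a *: x + y) z = a * bform x z + bform y z.
Proof.
by rewrite /bform linearD linearZ /= !mulmxDl -!scalemxAl !mxE.
Qed.

Lemma bform_delta (i j : 'I_n) : bform (delta_mx i 0) (delta_mx j 0) = A i j.
Proof. by rewrite /bform trmx_delta -rowE -colE !mxE. Qed.

(** The zero summand lets [bformDl] expand all three terms uniformly. *)
Definition trinomial (a b c : R) (i j k : 'I_n) : 'cV[R]_n :=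
  a *: delta_mx i 0 + (b *: delta_mx j 0 + (c *: delta_mx k 0 + 0)).

Lemma bform_trinomial a b c i j k z : bform (trinomial a b c i j k) z =
  a * bform (delta_mx i 0) z + b * bform (delta_mx j 0) z +
  c * bform (delta_mx k 0) z.
Proof.
rewrite !bformDl (_ : bform 0 z = 0); last by rewrite /bform trmx0 !mul0mx mxE.
by ring.
Qed.

Lemma qform_trinomial a b c i j k : qform A (trinomial a b c i j k) =
  a ^+ 2 * A i i + b ^+ 2 * A j j + c ^+ 2 * A k k +
  2 * (a * b * A i j + a * c * A i k + b * c * A j k).
Proof.
have -> : forall z, qform A z = bform z z by [].
rewrite bform_trinomial !(bformC _ (trinomial _ _ _ _ _ _)) !bform_trinomial.
rewrite !bform_delta.
have symA u v : A u v = A v u by rewrite -{1}A_sym mxE.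
rewrite (symA j i) (symA k i) (symA k j); ring.
Qed.

End Trinomial.

(** A semidefinite matrix annihilates its isotropic vectors. *)
Lemma psd_relation (R : realType) (n : nat) (A : 'M[R]_n) (a b c : R)
    (i j k l : 'I_n) :
  psd A -> qform A (trinomial a b c i j k) = 0 ->
  a * A i l + b * A j l + c * A k l = 0.
Proof.
move=> [A_sym A_ge0] q0.
have : bform A (trinomial a b c i j k) (delta_mx l 0) = 0.
  apply: (@isotropic_orthogonal R 'cV[R]_n (bform A) (fun=> True)
    _ _ (bformC A_sym) (bformDl A)) => //.
  by move=> u _; exact: A_ge0.
by rewrite bform_trinomial !bform_delta.
Qed.

Section Completion.
Variables (R : realType) (N : nat).
Local Notation n := N.+4.
Local Notation G := (zigzag n).
Local Notation q := (q R).
Local Notation len := (len R).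
Local Notation cos := (@zigzag_cos R n).
Local Notation vtx := (vtx N).
Local Notation base_vtx := (base_vtx N).

Definition gram_factor : 'M[R]_(n, 3) := \matrix_(i, k) gram_col R n k i 0.

Lemma gram_mul : gram R n = gram_factor *m gram_factor^T.
Proof.
by apply/matrixP => i j; rewrite !mxE; apply: eq_bigr => k _; rewrite !mxE.
Qed.

Lemma gram_psd : psd (gram R n).
Proof.
rewrite gram_mul; split; first by rewrite trmx_mul trmxK.
move=> x; rewrite /qform mulmxA -mulmxA mxE sumr_ge0 // => k _.
have -> : gram_factor^T *m x = (x^T *m gram_factor)^T.
  by rewrite trmx_mul trmxK.
by rewrite [_^T _ _]mxE -expr2 sqr_ge0.
Qed.

Lemma gram_feasible : feasible cos (gram R n).
Proof.
split=> //; first exact: gram_psd.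
by move=> i; rewrite mxE gram_unit.
Qed.

Lemma zigzag_completable : completable cos.
Proof.
split=> [e|]; last by exists (gram R n); exact: gram_feasible.
have [[X_sym X_ge0] X1 Xe] := gram_feasible; rewrite -Xe.
have := X_ge0 (trinomial 1 1 0 (src e) (tgt e) (tgt e)).
have := X_ge0 (trinomial 1 (-1) 0 (src e) (tgt e) (tgt e)).
by rewrite !qform_trinomial // !X1 => ? ?; apply/andP; split; lra.
Qed.

Lemma feasible_entry X i j : feasible cos X -> (i < n)%N -> (j < n)%N ->
  [|| i == j, (i < j)%N && below i j | (j < i)%N && below j i] ->
  len i * len j * X (vtx i) (vtx j) = dot R i j.
Proof.
move=> [[X_sym _] X1 Xe] hi hj ij.
suff -> : X (vtx i) (vtx j) = dot R i j / (len i * len j).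
  by field; rewrite !len_neq0.
wlog le_ij : i j hi hj ij / (i <= j)%N => [IH|].
  case/orP: (leq_total i j) => [|le_ji]; first exact: IH.
  rewrite -X_sym mxE (IH j i) //; first by rewrite dotC (mulrC (len i)).
  by rewrite eq_sym [X in _ || X]orbC.
case: (eqVneq i j) ij => [<- _|ne_ij /= ij].
  by rewrite X1 len_sqr divff // gt_eqF // dot_gt0.
have lt_ij : (i < j)%N by rewrite ltn_neqAle ne_ij.
rewrite lt_ij ltnNge le_ij /= orbF in ij.
have Pij : ((vtx i, vtx j).1 < (vtx i, vtx j).2)%N &&
    G (vtx i, vtx j).1 (vtx i, vtx j).2.
  by rewrite /= /zigzag_adj /= !vtxK // lt_ij ij.
have := Xe (exist _ (vtx i, vtx j) Pij : edge G).
by rewrite /zigzag_cos gramE /src /tgt /= !vtxK.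
Qed.

(** The relation of [m] is an isotropic vector of [X]: its value involves the
    entries at the edges from [m] and the entry at (m - 1, odd m), and the latter
    agrees with the Gram matrix by the relation of m - 1 applied to column
    odd m. *)
Lemma feasible_extrapolated X m j : feasible cos X -> (m < n)%N ->
  scaled (col j X) m = extrapolated (col j X) m.
Proof.
move=> X_feas; have [X_psd _ _] := X_feas.
elim/ltn_ind: m j => m IH j hm.
have [m4|m4] := ltnP m 4.
  have [->|m2] := eqVneq m 2.
    have -> : extrapolated (col j X) 2 = scaled (col j X) 0.
      by rewrite (scaled_odd _ false).
    have := @psd_relation R n X (len 2) (- len 0) 0 (vtx 2) (vtx 0) (vtx 0) j X_psd.
    rewrite qform_trinomial; last by case: X_psd.
    have E22 := @feasible_entry X 2 2 X_feas isT isT isT.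
    have E00 := @feasible_entry X 0 0 X_feas isT isT isT.
    have E20 := @feasible_entry X 2 0 X_feas isT isT isT.
    have d22 : dot R 2 2 = dot R 0 0 by [].
    have d20 : dot R 2 0 = dot R 0 0 by [].
    rewrite /scaled !mxE => H; apply/eqP; rewrite -subr_eq0; apply/eqP.
    by rewrite -[RHS]H; [ring | lra].
  have [k <-] : exists k : 'I_3, base k = m.
    by case: m m4 m2 {IH hm} => [|[|[|[|m]]]] // _ _; [exists 0 | exists 1 | exists 2].
  by rewrite scaled_base extrapolated_base.
have hm1 : (m.-1 < n)%N by lia.
have ho : (odd m < n)%N by lia.
have E1 := @feasible_entry X m m X_feas hm hm ltac:(lia).
have E2 := @feasible_entry X m.-1 m.-1 X_feas hm1 hm1 ltac:(lia).
have E3 := @feasible_entry X (odd m) (odd m) X_feas ho ho ltac:(lia).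
have E4 := @feasible_entry X m m.-1 X_feas hm hm1 ltac:(rewrite /below; lia).
have E5 := @feasible_entry X m (odd m) X_feas hm ho ltac:(rewrite /below; lia).
have E6 : len m.-1 * len (odd m) * X (vtx m.-1) (vtx (odd m)) = dot R m.-1 (odd m).
  have := IH m.-1 ltac:(lia) (vtx (odd m)) hm1; rewrite /scaled mxE => Em1.
  rewrite mulrAC Em1 /extrapolated mulr_suml; apply: eq_bigr => k _.
  rewrite -mulrA; congr (_ * _); rewrite mxE mulrC.
  have hk : (base k < n)%N by have := base_lt4 (ltn_ord k); lia.
  have := @feasible_entry X (base k) (odd m) X_feas hk ho.
  rewrite len_base mul1r dotC dot_base; apply.
  by have := base_lt4 (ltn_ord k); rewrite /below; lia.
have := @psd_relation R n X (len m) (- len m.-1) (- len (odd m))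
  (vtx m) (vtx m.-1) (vtx (odd m)) j X_psd.
rewrite qform_trinomial; last by case: X_psd.
have known : scaled (col j X) m.-1 = extrapolated (col j X) m.-1.
  by apply: IH => //; lia.
rewrite extrapolated_step // -known -scaled_odd /scaled !mxE => H.
apply/eqP; rewrite -subr_eq0; apply/eqP; rewrite -[RHS]H; first by ring.
have D1 := dot_step R m m4; have D2 := dot_step R m.-1 m4.
have D3 := dot_step R (odd m) m4.
rewrite (dotC R (odd m) m) (dotC R (odd m) m.-1) in D3.
rewrite (dotC R m.-1 m) in D2.
by lra.
Qed.

Lemma feasible_rank X : feasible cos X -> (\rank X <= 3)%N.
Proof.
move=> X_feas.
have -> : X = gram_factor *m \matrix_(k < 3, j < n) X (base_vtx k) j.
  apply/matrixP => i j.
  have := extrapolated_colE (fun m hm => feasible_extrapolated j X_feas hm).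
  move=> /colP/(_ i); rewrite summxE !mxE => ->; apply: eq_bigr => k _.
  by rewrite !mxE mulrC.
exact: leq_trans (mxrankM_maxl _ _) (rank_leq_col _).
Qed.

Lemma gram_rank : \rank (gram R n) = 3.
Proof.
apply/eqP; rewrite eqn_leq (feasible_rank gram_feasible) /=.
pose L : 'M[R]_(3, n) := \matrix_(k, i) (i == base_vtx k)%:R.
have LM : L *m gram_factor = 1%:M.
  apply/matrixP => k l; rewrite !mxE (bigD1 (base_vtx k)) //= !mxE eqxx mul1r.
  rewrite big1 ?addr0 => [|i ik]; last by rewrite !mxE (negPf ik) mul0r.
  by have := gram_col_base R N l k; rewrite mxE => ->.
have <- : \rank (L *m gram R n *m L^T) = 3.
  rewrite gram_mul mulmxA LM mul1mx -trmx_mul LM trmx1; exact: mxrank1.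
exact: leq_trans (mxrankM_maxl _ _) (mxrankM_maxr _ _).
Qed.

Lemma zigzag_max_rank s : is_max_rank cos s <-> s = 3.
Proof.
split=> [[[X [X_feas <-]] max_s]|->].
  apply/eqP; rewrite eqn_leq feasible_rank //= -gram_rank.
  by apply: max_s; exact: gram_feasible.
split; first by exists (gram R n); split; [exact: gram_feasible | exact: gram_rank].
exact: feasible_rank.
Qed.

(** Vertices 0 and 2 are placed at the same point, so the difference of the two
    unit vectors is isotropic for every feasible solution. *)
Lemma zigzag_singular : ~ has_posdef_solution cos.
Proof.
move=> [X [X_feas [_ X_pos]]].
pose d := trinomial (len 2) (- len 0) 0 (vtx 2) (vtx 0) (vtx 0).
have d_neq0 : d != 0.
  apply/eqP => /colP/(_ (vtx 2)); rewrite !mxE !eqxx /=.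
  have -> : (vtx 2 == vtx 0) = false by rewrite -val_eqE /= !vtxK.
  by rewrite !mulr0 !addr0 mulr1 => /eqP; rewrite (negPf (len_neq0 R 2)).
have := X_pos d d_neq0.
rewrite qform_trinomial; last by case: X_feas => [[]].
have E22 := @feasible_entry X 2 2 X_feas isT isT isT.
have E00 := @feasible_entry X 0 0 X_feas isT isT isT.
have E20 := @feasible_entry X 2 0 X_feas isT isT isT.
have d22 : dot R 2 2 = dot R 0 0 by [].
have d20 : dot R 2 0 = dot R 0 0 by [].
by lra.
Qed.

(** * The singularity degree *)

Lemma zigzag_sd_sequence : exists w : 'I_n -> stress R G, sd_sequence cos w.
Proof.
have /fin_all_exists[w wE] : forall m : 'I_n, exists w : stress R G, forall x,
    (forall i, (i < m)%N -> scaled x i = extrapolated x i) ->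
    qform (stress_mx w) x = (scaled x m - extrapolated x m) ^+ 2.
  by move=> m; exact: edge_form_relation.
have w_stage : stage_seq w by [].
exists w; split=> [j x Vx|j|].
- by rewrite (wE j x) ?sqr_ge0 //; apply/(Vset_stage x w_stage) => //; exact: ltnW.
- rewrite (pairing_gram (@gram_unit R n) (@gram_edge R n)) big1 // => k _.
  rewrite -qform_stress (wE j) => [|i ij].
    by rewrite scaled_gram_col // extrapolated_gram_col subrr expr0n.
  by rewrite scaled_gram_col ?extrapolated_gram_col // (ltn_trans ij).
exists 3; split; first by apply/zigzag_max_rank.
exists (gram_space R N); split; last exact: dim_gram_space.
by move=> x; rewrite gram_spaceP; exact: Vset_stage.
Qed.

Lemma dim_gt_gram_space (W : {vspace 'cV[R]_n}) (f : 'cV[R]_n) :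
  (forall k, gram_col R n k \in W) -> f \in W ->
  (forall k, f (base_vtx k) 0 = 0) -> f != 0 -> (3 < \dim W)%N.
Proof.
move=> P_in f_in f_base f_neq0.
pose s := [tuple gram_col R n k | k < 3].
have f_notin : f \notin <<s>>%VS.
  apply: contra f_neq0 => /gram_spaceP/extrapolated_colE ->.
  by rewrite big1 // => k _; rewrite f_base scale0r.
have : free (f :: s) by rewrite free_cons f_notin gram_free.
rewrite /free [size _]/= size_tuple => /eqP dim_fs.
apply: (@leq_trans (\dim <<f :: s>>)); first by rewrite dim_fs ltnS ?card_ord.
apply/dimvS/span_subvP => v.
by rewrite inE => /orP[/eqP -> //|/tnthP[k ->]]; rewrite tnth_mktuple.
Qed.

(** After too few steps, V^k contains besides the coordinate columns of the
    points the displacement of the last vertex alone; before the first step it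
    contains everything. *)
Lemma zigzag_sd_ge k (w : 'I_k -> stress R G) :
  sd_sequence cos w -> (maxn 1 N <= k)%N.
Proof.
move=> [w_ge0 w_le0 [s [/zigzag_max_rank -> [W [WE dimW]]]]].
have gram_k l : gram_col R n l \in W.
  by apply/WE; have [_] := rise_survives w_ge0 w_le0 (leqnn (k + 4)).
rewrite leqNgt; apply/negP => k_small.
suff [f [f_in f_base f_neq0]] :
    exists f : 'cV[R]_n, [/\ f \in W, forall l, f (base_vtx l) 0 = 0 & f != 0].
  by have := dim_gt_gram_space gram_k f_in f_base f_neq0; rewrite dimW.
have [k0|k_gt0] := posnP k.
  exists (delta_mx (vtx 2) 0); split.
  - by apply/WE => i _; have := ltn_ord i; rewrite [X in (_ < X)%N]k0.
  - move=> l; rewrite mxE -val_eqE /= vtxK // base_vtxK.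
    by case: l => [[|[|[|l]]]].
  - by apply/eqP => /colP/(_ (vtx 2)); rewrite !mxE !eqxx => /eqP; rewrite oner_eq0.
have k_lt : (k + 4 <= N.+3)%N by move: k_small; rewrite leq_max; lia.
exists (scaled_col n (rise R N.+3)); split.
- by apply/WE; have [] := rise_survives w_ge0 w_le0 k_lt.
- move=> l; rewrite !mxE base_vtxK /rise.
  have -> : (N.+3 <= base l)%N = false by have := base_lt4 (ltn_ord l); lia.
  by rewrite mul0r.
apply/eqP => /colP/(_ ord_max); rewrite !mxE /rise leqnn mul1r => /eqP.
by rewrite invr_eq0 (negPf (len_neq0 R _)).
Qed.

End Completion.

Theorem corollary7p2 (R : realType) (n : nat) (hn : (4 <= n)%N) :
  exists G : sgraph 'I_n,
    is_treewidth G 3 /\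
    exists d : nat, is_sd R G d /\ ((n - 1) %/ 3 <= d)%N.
Proof.
exists (zigzag n); split; first exact: zigzag_treewidth.
case: n hn => [|[|[|[|N]]]] // _.
have [w w_seq] := zigzag_sd_sequence R N.
have [k k_sd] := sd_at_exists (@zigzag_singular R N) w_seq.
have [d [d_sd kd]] := is_sd_exists (@zigzag_completable R N) k_sd.
exists d; split=> //; apply: leq_trans kd.
case: k_sd => [[/zigzag_singular //]|[_ [w' /zigzag_sd_ge] + _]].
by apply: leq_trans; lia.
Qed.
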